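(* Let $R$ be a ring and $\mathbf R=R^{\mathrm{mon}}$ its associated monomial ordered blueprint. The association $\mathbf v\mapsto\mathbf v^\bullet$, sending a morphism of ordered blueprints $\mathbf v:\mathbf R\to\mathbf T$ into the tropical hyperfield to its underlying map $\mathbf v^\bullet:R=\mathbf R^\bullet\to\mathbf T^\bullet=\mathbb{R}_{\geq0}$, defines a bijection $$\Phi:\operatorname{Hom}(\mathbf R,\mathbf T)\longrightarrow\{\text{nonarchimedean seminorms on }R\}.$$
   Context: All rings, semirings and monoids are commutative; semirings have $0$ and $1$. An ordered blueprint is a triple $B=(B^\bullet,B^+,\leq)$ where $B^+$ is a semiring, $B^\bullet\subset B^+$ is a multiplicatively closed subset containing $0,1$ that generates $B^+$ as a semiring, and $\leq$ is a partial order on $B^+$ that is additive and multiplicative ($x\leq y$ implies $x+z\leq y+z$ and $xz\leq yz$). The order is generated by a set of relations if it is the smallest additive and multiplicative partial order containing them. A morphism $f:B\to C$ is a multiplicative map $f^\bullet:B^\bullet\to C^\bullet$ preserving $0$ and $1$ that extends (necessarily uniquely) to an order-preserving semiring homomorphism $B^+\to C^+$; $\operatorname{Hom}(B,C)$ is the set of morphisms. For a monoid with zero $M$ let $M^+$ be the semiring $\mathbb{N}[M]$ of finite formal sums of elements of $M$, modulo identifying $0\in M$ with the empty sum. For a ring $R$ with multiplicative monoid $R^\bullet$, $R^{\mathrm{mon}}=(R^\bullet,(R^\bullet)^+,\leq)$ with $\leq$ generated by the relations $c\leq a+b$ for $a,b,c\in R$ with $c=a+b$ in $R$. The tropical hyperfield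 is the ordered blueprint $\mathbf T$ with $\mathbf T^\bullet=(\mathbb{R}_{\geq0},\cdot)$, $\mathbf T^+=\mathbb{N}[\mathbb{R}_{>0}]=(\mathbf T^\bullet)^+$ and $\leq$ generated by the relations $c\leq a+b$ for all $a,b,c\in\mathbb{R}_{\geq0}$ such that the maximum among $a,b,c$ occurs (at least) twice. A nonarchimedean seminorm on $R$ is a map $v:R\to\mathbb{R}_{\geq0}$ with $v(0)=0$, $v(1)=1$, $v(ab)=v(a)v(b)$ and $v(a+b)\leq\max\{v(a),v(b)\}$ for all $a,b\in R$ (with $\leq$ the usual order of $\mathbb{R}_{\geq 0}$). *)

(* Defs.v *)
From HB Require Import structures.
From mathcomp Require Import all_boot all_order all_algebra.
From mathcomp Require Import generic_quotient interval_inference.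
From mathcomp Require Import boolp classical_sets functions reals.

Set Implicit Arguments.
Unset Strict Implicit.
Unset Printing Implicit Defensive.

Import Order.TTheory GRing.Theory Num.Theory.
Local Open Scope quotient_scope.
Local Open Scope ring_scope.

HB.mixin Record isComMonoid0 M of Choice M := {
  mzero : M;
  mone : M;
  mmul : M -> M -> M;
  mmulA : associative mmul;
  mmulC : commutative mmul;
  mmul1m : left_id mone mmul;
  mmul0m : left_zero mzero mmul;
}.

#[short(type="comMonoid0Type")]
HB.structure Definition ComMonoid0 := {M of isComMonoid0 M & Choice M}.

Arguments mzero {s}.
Arguments mone {s}.

(* The multiplicative monoid of a commutative ring; the zero ring is allowed. *)
Definition mulmon (R : comPzRingType) : Type := R.

HB.instance Definition _ (R : comPzRingType) := Choice.on (mulmon R).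
HB.instance Definition _ (R : comPzRingType) :=
  isComMonoid0.Build (mulmon R) (@mulrA R) (@mulrC R) (@mul1r R) (@mul0r R).

Definition nnreal (K : realType) : Type := {nonneg K}.

HB.instance Definition _ (K : realType) := Choice.on (nnreal K).

Section NonnegMonoid.
Variable K : realType.
Implicit Types a b c : {nonneg K}.

Definition nng_mul a b : {nonneg K} := (a%:num * b%:num)%:nng.

Lemma nng_mulA : associative nng_mul.
Proof. by move=> a b c; apply/val_inj; rewrite /= mulrA. Qed.

Lemma nng_mulC : commutative nng_mul.
Proof. by move=> a b; apply/val_inj; rewrite /= mulrC. Qed.

Lemma nng_mul1 : left_id 1%:nng nng_mul.
Proof. by move=> a; apply/val_inj; rewrite /= mul1r. Qed.

Lemma nng_mul0 : left_zero 0%:nng nng_mul.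
Proof. by move=> a; apply/val_inj; rewrite /= mul0r. Qed.

HB.instance Definition _ :=
  isComMonoid0.Build (nnreal K) nng_mulA nng_mulC nng_mul1 nng_mul0.

End NonnegMonoid.

(* The semiring M^+ of a monoid with zero M.  A finite formal sum is a list of
   its terms, taken up to reordering; identifying the zero of M with the empty
   sum amounts to disregarding the terms equal to that zero. *)
Section FormalSums.
Variable M : comMonoid0Type.
Implicit Types (s t : seq M) (m a b : M).

Definition nzterms s : seq M := [seq m <- s | m != mzero].

Definition fsum_eqv s t : bool := perm_eq (nzterms s) (nzterms t).

Lemma fsum_eqv_refl : reflexive fsum_eqv.
Proof. by move=> s; apply: perm_refl. Qed.

Lemma fsum_eqv_sym : symmetric fsum_eqv.
Proof. by move=> s t; apply: perm_sym. Qed.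

Lemma fsum_eqv_trans : transitive fsum_eqv.
Proof. by move=> t s u; apply: perm_trans. Qed.

Canonical fsum_equiv :=
  EquivRel fsum_eqv fsum_eqv_refl fsum_eqv_sym fsum_eqv_trans.

Definition fsum : Type := {eq_quot fsum_eqv}.

HB.instance Definition _ := Choice.on fsum.

Definition fsum_of s : fsum := \pi_{eq_quot fsum_eqv} s.

Lemma fsum_eqP s t : reflect (fsum_of s = fsum_of t) (fsum_eqv s t).
Proof. by apply: (iffP idP) => /eqmodP. Qed.

Definition fsum_terms (x : fsum) : seq M := repr (x : {eq_quot fsum_eqv}).

Lemma fsum_termsK x : fsum_of (fsum_terms x) = x.
Proof. exact: reprK. Qed.

Lemma fsum_terms_eqv s : fsum_eqv (fsum_terms (fsum_of s)) s.
Proof. by apply/fsum_eqP; rewrite fsum_termsK. Qed.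

Definition fsum_zero : fsum := fsum_of [::].
Definition fsum_one : fsum := fsum_of [:: mone].
Definition fsum_add (x y : fsum) : fsum := fsum_of (fsum_terms x ++ fsum_terms y).
Definition fsum_mul (x y : fsum) : fsum :=
  fsum_of [seq mmul a b | a <- fsum_terms x, b <- fsum_terms y].

Lemma perm_fsum s t : perm_eq s t -> fsum_of s = fsum_of t.
Proof. by move=> st; apply/fsum_eqP; rewrite /fsum_eqv perm_filter. Qed.

Lemma fsum_of_nz s : fsum_of (nzterms s) = fsum_of s.
Proof.
by apply/fsum_eqP; rewrite /fsum_eqv /nzterms filter_id.
Qed.

Lemma fsum_addE s t : fsum_add (fsum_of s) (fsum_of t) = fsum_of (s ++ t).
Proof.
apply/fsum_eqP; rewrite /fsum_eqv /nzterms !filter_cat.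
by apply: perm_cat; apply: fsum_terms_eqv.
Qed.

Lemma mmulm0 m : mmul m mzero = mzero.
Proof. by rewrite mmulC mmul0m. Qed.

Lemma mmulm1 m : mmul m mone = m.
Proof. by rewrite mmulC mmul1m. Qed.

Lemma map_mmul_nz a t :
  nzterms [seq mmul a b | b <- nzterms t] = nzterms [seq mmul a b | b <- t].
Proof.
elim: t => //= b t IH; case: eqP => [->|_] /=; first by rewrite mmulm0 eqxx.
by case: ifP; rewrite IH.
Qed.

Lemma map_mmul0 t : nzterms [seq mmul mzero b | b <- t] = [::].
Proof. by elim: t => //= b t IH; rewrite mmul0m eqxx. Qed.

Lemma allpairs_nz s t :
  nzterms [seq mmul a b | a <- nzterms s, b <- nzterms t] =
  nzterms [seq mmul a b | a <- s, b <- t].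
Proof.
elim: s => //= a s IH; case: eqP => [->|_] /=.
  by rewrite IH /nzterms filter_cat -!/(nzterms _) map_mmul0.
by rewrite /nzterms !filter_cat -!/(nzterms _) map_mmul_nz IH.
Qed.

Lemma fsum_mulE s t :
  fsum_mul (fsum_of s) (fsum_of t) = fsum_of [seq mmul a b | a <- s, b <- t].
Proof.
have nz s' t' : fsum_of [seq mmul a b | a <- s', b <- t'] =
    fsum_of [seq mmul a b | a <- nzterms s', b <- nzterms t'].
  by rewrite -fsum_of_nz -allpairs_nz fsum_of_nz.
rewrite /fsum_mul nz [RHS]nz.
by apply/perm_fsum/perm_allpairs; apply: fsum_terms_eqv.
Qed.

Lemma fsum_addA : associative fsum_add.
Proof.
move=> x y z; rewrite -(fsum_termsK x) -(fsum_termsK y) -(fsum_termsK z).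
by rewrite !fsum_addE catA.
Qed.

Lemma fsum_addC : commutative fsum_add.
Proof. by move=> x y; apply/perm_fsum; rewrite perm_catC. Qed.

Lemma fsum_add0 : left_id fsum_zero fsum_add.
Proof. by move=> x; rewrite -(fsum_termsK x) fsum_addE. Qed.

HB.instance Definition _ :=
  GRing.isNmodule.Build fsum fsum_addA fsum_addC fsum_add0.

Lemma fsum_mulA : associative fsum_mul.
Proof.
move=> x y z; rewrite -(fsum_termsK x) -(fsum_termsK y) -(fsum_termsK z).
move: (fsum_terms x) (fsum_terms y) (fsum_terms z) => s t u.
rewrite !fsum_mulE; congr fsum_of.
elim: s => //= a s ->; rewrite allpairs_cat; congr (_ ++ _).
elim: t => //= b t IH; rewrite map_cat IH; congr (_ ++ _).
by rewrite -map_comp; apply: eq_map => c /=; rewrite mmulA.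
Qed.

Lemma fsum_mulC : commutative fsum_mul.
Proof.
move=> x y; rewrite /fsum_mul; apply: perm_fsum.
move: (fsum_terms x) (fsum_terms y) => s t.
elim: s => [|a s IH] /=; first by elim: t.
rewrite perm_sym (perm_allpairs_consr _ _ (fun=> a)) perm_sym.
by apply: perm_cat => //; rewrite (eq_map (fun b => mmulC a b)).
Qed.

Lemma fsum_mul1 : left_id fsum_one fsum_mul.
Proof.
move=> x; rewrite -(fsum_termsK x) fsum_mulE /= cats0.
by rewrite (eq_map mmul1m) map_id.
Qed.

Lemma fsum_mulD : left_distributive fsum_mul fsum_add.
Proof.
move=> x y z; rewrite -(fsum_termsK x) -(fsum_termsK y) -(fsum_termsK z).
by rewrite !(fsum_addE, fsum_mulE) allpairs_cat.
Qed.

Lemma fsum_mul0 : left_zero fsum_zero fsum_mul.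
Proof. by move=> x; rewrite -(fsum_termsK x) fsum_mulE. Qed.

HB.instance Definition _ := GRing.Nmodule_isComPzSemiRing.Build fsum
  fsum_mulA fsum_mulC fsum_mul1 fsum_mulD fsum_mul0.

Definition fsum_inj m : fsum := fsum_of [:: m].

Lemma fsum_inj0 : fsum_inj mzero = 0.
Proof. by apply/fsum_eqP; rewrite /fsum_eqv /= eqxx. Qed.

Lemma fsum_inj1 : fsum_inj mone = 1.
Proof. by []. Qed.

Lemma fsum_injM a b : fsum_inj (mmul a b) = fsum_inj a * fsum_inj b.
Proof. by rewrite [RHS]fsum_mulE. Qed.

Lemma fsum_inj_inj : injective fsum_inj.
Proof.
move=> a b /fsum_eqP; rewrite /fsum_eqv /=.
case: eqP => [->|_]; case: eqP => [->|_] //=.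
- by move/perm_size.
- by move/perm_size.
- by move/perm_mem/(_ a); rewrite !inE eqxx => /esym/eqP.
Qed.

Lemma fsum_ind (P : fsum -> Prop) :
  P 0 -> (forall m x, P x -> P (fsum_inj m + x)) -> forall x, P x.
Proof.
move=> P0 PD x; rewrite -(fsum_termsK x); elim: (fsum_terms x) => //= m s Ps.
by rewrite -cat1s -fsum_addE; apply: PD.
Qed.

End FormalSums.

Definition add_mul_order (S : comPzSemiRingType) (le : S -> S -> Prop) : Prop :=
  [/\ forall x, le x x,
      forall x y, le x y -> le y x -> x = y,
      forall y x z, le x y -> le y z -> le x z,
      forall x y z, le x y -> le (x + z) (y + z)
    & forall x y z, le x y -> le (x * z) (y * z)].

(* The subset of B^+ is rendered as a monoid with zero together with an injective
   map ob_inj into B^+, so that the carrier of R^mon is literally R. *)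
Record ordered_blueprint := OrderedBlueprint {
  ob_bullet : comMonoid0Type;
  ob_plus : comPzSemiRingType;
  ob_inj : ob_bullet -> ob_plus;
  ob_inj_inj : injective ob_inj;
  ob_inj0 : ob_inj mzero = 0;
  ob_inj1 : ob_inj mone = 1;
  ob_injM : forall a b, ob_inj (mmul a b) = ob_inj a * ob_inj b;
  ob_gen : forall P : ob_plus -> Prop,
    P 0 -> P 1 -> (forall x y, P x -> P y -> P (x + y)) ->
    (forall x y, P x -> P y -> P (x * y)) ->
    (forall a, P (ob_inj a)) -> forall x, P x;
  ob_le : ob_plus -> ob_plus -> Prop;
  ob_le_order : add_mul_order ob_le;
}.

Record ob_hom (B C : ordered_blueprint) := OBHom {
  hom_bullet :> ob_bullet B -> ob_bullet C;
  hom_bullet0 : hom_bullet mzero = mzero;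
  hom_bullet1 : hom_bullet mone = mone;
  hom_bulletM : forall a b,
    hom_bullet (mmul a b) = mmul (hom_bullet a) (hom_bullet b);
  hom_extends : exists F : {rmorphism ob_plus B -> ob_plus C},
    (forall a, F (ob_inj a) = ob_inj (hom_bullet a)) /\
    (forall x y, ob_le x y -> ob_le (F x) (F y));
}.

(* The intersection of all additive and multiplicative partial orders that
   contain r; it is the smallest one as soon as there is one. *)
Definition gen_order (S : comPzSemiRingType) (r : S -> S -> Prop) (x y : S) :
    Prop :=
  forall le : S -> S -> Prop, add_mul_order le ->
    (forall u v, r u v -> le u v) -> le x y.

Lemma gen_order_order (S : comPzSemiRingType) (r le0 : S -> S -> Prop) :
  add_mul_order le0 -> (forall u v, r u v -> le0 u v) ->
  add_mul_order (gen_order r).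
Proof.
move=> le0_order r_le0; split.
- by move=> x le [].
- move=> x y xy yx; have [_ anti _ _ _] := le0_order.
  by apply: anti; [apply: xy | apply: yx].
- move=> y x z xy yz le le_order rle; have [_ _ trans _ _] := le_order.
  by apply: (trans y); [apply: xy | apply: yz].
- move=> x y z xy le le_order rle; have [_ _ _ add _] := le_order.
  by apply: add; apply: xy.
- move=> x y z xy le le_order rle; have [_ _ _ _ mul] := le_order.
  by apply: mul; apply: xy.
Qed.

(* The relations c <= a + b on M^+, for (c, a, b) in r. *)
Definition add_rel (M : comMonoid0Type) (r : M -> M -> M -> Prop)
    (x y : fsum M) : Prop :=
  exists c a b, [/\ r c a b, x = fsum_inj c & y = fsum_inj a + fsum_inj b].

(* A partial order containing add_rel r: sequences of replacements of a term c
   by a + b, which are trivial or increase the number of nonzero terms. *)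
Section AddRelOrder.
Variables (M : comMonoid0Type) (r : M -> M -> M -> Prop).
Hypothesis r_scale : forall m c a b, r c a b -> r (mmul m c) (mmul m a) (mmul m b).
Hypothesis r_0l : forall c b, r c mzero b -> c = b.
Hypothesis r_0r : forall c a, r c a mzero -> c = a.
Implicit Types x y z : fsum M.

Inductive rewrites : fsum M -> fsum M -> Prop :=
| rewrites_refl x : rewrites x x
| rewrites_step x c a b y : r c a b ->
    rewrites (x + (fsum_inj a + fsum_inj b)) y -> rewrites (x + fsum_inj c) y.

Lemma rewrites_trans y x z : rewrites x y -> rewrites y z -> rewrites x z.
Proof.
by elim=> // {}x c a b {}y rcab _ IH yz; apply: rewrites_step rcab _; apply: IH.
Qed.

Lemma rewritesD x y z : rewrites x y -> rewrites (x + z) (y + z).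
Proof.
elim=> [{}x|{}x c a b {}y rcab _ IH]; first exact: rewrites_refl.
by rewrite addrAC; apply: rewrites_step rcab _; rewrite addrAC.
Qed.

Lemma rewritesM x y z : rewrites x y -> rewrites (x * z) (y * z).
Proof.
elim/fsum_ind: z x y => [|m z IHz] x y xy.
  by rewrite !mulr0; apply: rewrites_refl.
rewrite !mulrDr; apply: (rewrites_trans (y := y * fsum_inj m + x * z)).
  apply: rewritesD; elim: xy => [{}x|{}x c a b {}y rcab _ IH].
    exact: rewrites_refl.
  rewrite mulrDl -fsum_injM mmulC; apply: (rewrites_step (r_scale m rcab)).
  by rewrite !fsum_injM ![fsum_inj m * _]mulrC -!mulrDl.
by rewrite addrC [_ + y * z]addrC; apply/rewritesD/IHz.
Qed.

Definition fsum_len x : nat := size (nzterms (fsum_terms x)).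

Lemma fsum_len_of s : fsum_len (fsum_of s) = size (nzterms s).
Proof. exact/perm_size/fsum_terms_eqv. Qed.

Lemma fsum_lenD x y : fsum_len (x + y) = (fsum_len x + fsum_len y)%N.
Proof.
rewrite -(fsum_termsK x) -(fsum_termsK y) [_ + _]fsum_addE !fsum_len_of.
by rewrite /nzterms filter_cat size_cat.
Qed.

Lemma fsum_len_inj m : fsum_len (fsum_inj m) = (m != mzero).
Proof. by rewrite fsum_len_of /=; case: ifP. Qed.

Lemma rewrites_len x y : rewrites x y -> x = y \/ (fsum_len x < fsum_len y)%N.
Proof.
elim=> [{}x|{}x c a b {}y rcab _ IH]; first by left.
have [a0|a0] := eqVneq a mzero.
  move: rcab IH; rewrite a0 => /r_0l ->.
  by rewrite fsum_inj0 add0r.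
have [b0|b0] := eqVneq b mzero.
  move: rcab IH; rewrite b0 => /r_0r ->.
  by rewrite fsum_inj0 addr0.
have lt_len : (fsum_len (x + fsum_inj c)%R
               < fsum_len (x + (fsum_inj a + fsum_inj b))%R)%N.
  by rewrite !fsum_lenD !fsum_len_inj a0 b0 ltn_add2l ltnS leq_b1.
by right; case: IH => [<- //|]; apply: ltn_trans.
Qed.

Lemma rewrites_order : add_mul_order rewrites.
Proof.
split.
- exact: rewrites_refl.
- move=> x y /rewrites_len[//|xy] /rewrites_len[//|yx].
  by have := ltn_trans xy yx; rewrite ltnn.
- exact: rewrites_trans.
- exact: rewritesD.
- exact: rewritesM.
Qed.

Lemma add_rel_order : add_mul_order (gen_order (add_rel r)).
Proof.
apply: gen_order_order rewrites_order _ => _ _ [c [a [b [rcab -> ->]]]].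
rewrite -[fsum_inj c]add0r; apply: rewrites_step rcab _.
by rewrite add0r; apply: rewrites_refl.
Qed.

End AddRelOrder.

Lemma fsum_gen (M : comMonoid0Type) (P : fsum M -> Prop) :
  P 0 -> P 1 -> (forall x y, P x -> P y -> P (x + y)) ->
  (forall x y, P x -> P y -> P (x * y)) ->
  (forall a, P (fsum_inj a)) -> forall x, P x.
Proof. by move=> P0 _ PD _ Pi; apply: fsum_ind => // m x; apply: PD. Qed.

Definition mon_rel (R : comPzRingType) (c a b : mulmon R) : Prop :=
  c = (a : R) + (b : R).

Lemma mon_order (R : comPzRingType) :
  add_mul_order (gen_order (add_rel (@mon_rel R))).
Proof.
apply: add_rel_order => [m c a b ->|c b ->|c a ->].
- exact: mulrDr.
- exact: add0r.
- exact: addr0.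
Qed.

Definition mon (R : comPzRingType) : ordered_blueprint :=
  {|
    ob_bullet := mulmon R;
    ob_plus := fsum (mulmon R);
    ob_inj := @fsum_inj (mulmon R);
    ob_inj_inj := @fsum_inj_inj _;
    ob_inj0 := fsum_inj0 _;
    ob_inj1 := fsum_inj1 _;
    ob_injM := @fsum_injM _;
    ob_gen := @fsum_gen _;
    ob_le := gen_order (add_rel (@mon_rel R));
    ob_le_order := @mon_order R
  |}.

Definition trop_rel (K : realType) (c a b : nnreal K) : Prop :=
  let s := [:: a%:num; b%:num; c%:num] in
  (2 <= count_mem (Num.max a%:num (Num.max b%:num c%:num)) s)%N.

Lemma trop_order (K : realType) :
  add_mul_order (gen_order (add_rel (@trop_rel K))).
Proof.
apply: add_rel_order => [m c a b|c b|c a]; rewrite /trop_rel /=.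
- have m0 : 0 <= m%:num by [].
  rewrite -!maxr_pMr // => h; apply: (leq_trans h).
  have eq_mul (x y : K) : ((x == y) <= (m%:num * x == m%:num * y)%R)%N.
    by case: eqP => // ->; rewrite eqxx.
  by rewrite !leq_add.
- have b0 : 0 <= b%:num by [].
  have c0 : 0 <= c%:num by [].
  move=> H; apply/val_inj => /=; move: H.
  by case: (ltgtP b%:num c%:num) => // bc; rewrite ?(max_r c0) ?(max_r b0)
     ?eqxx ?(lt_eqF bc) ?(gt_eqF bc) //;
     case: eqP => // e; move: bc; rewrite -e ltNge ?b0 ?c0.
- have a0 : 0 <= a%:num by [].
  have c0 : 0 <= c%:num by [].
  move=> H; apply/val_inj => /=; move: H; rewrite (max_r c0).
  by case: (ltgtP a%:num c%:num) => // ac; rewrite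
     ?eqxx ?(lt_eqF ac) ?(gt_eqF ac) //;
     case: eqP => // e; move: ac; rewrite -e ltNge ?a0 ?c0.
Qed.

Definition tropical_hyperfield (K : realType) : ordered_blueprint :=
  {|
    ob_bullet := nnreal K;
    ob_plus := fsum (nnreal K);
    ob_inj := @fsum_inj (nnreal K);
    ob_inj_inj := @fsum_inj_inj _;
    ob_inj0 := fsum_inj0 _;
    ob_inj1 := fsum_inj1 _;
    ob_injM := @fsum_injM _;
    ob_gen := @fsum_gen _;
    ob_le := gen_order (add_rel (@trop_rel K));
    ob_le_order := @trop_order K
  |}.

Definition nonarch_seminorm (K : realType) (R : comPzRingType)
    (v : R -> {nonneg K}) : Prop :=
  [/\ (v 0)%:num = 0,
      (v 1)%:num = 1,
      forall a b, (v (a * b))%:num = (v a)%:num * (v b)%:num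
    & forall a b, (v (a + b))%:num <= Num.max (v a)%:num (v b)%:num].

(* Main.v *)
Require Import Defs.
From HB Require Import structures.
From mathcomp Require Import all_boot all_order all_algebra.
From mathcomp Require Import interval_inference boolp classical_sets functions reals.

(** A generated order is carried into an additive and multiplicative order by a
    semiring morphism as soon as its generating relations are. Applied to the
    morphism from T^+ to the max-times semiring of nonnegative reals which sends
    a formal sum to its largest term, this shows that c <= a + b in T implies
    c <= max(a, b), so that a morphism R^mon -> T is a nonarchimedean seminorm.
    Applied to the extension R^+ -> T^+ of a seminorm v, it reduces the converse
    to the fact that the maximum of v(a), v(b), v(a + b) occurs twice, which
    holds because a = (a + b) - b and v(-b) = v(b). *)

Set Implicit Arguments.
Unset Strict Implicit.
Unset Printing Implicit Defensive.

Import Order.TTheory GRing.Theory Num.Theory.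
Local Open Scope classical_set_scope.
Local Open Scope ring_scope.

(** * Semiring morphisms out of formal sums *)

Section FsumExtension.
Variables (M : comMonoid0Type) (S : comPzSemiRingType) (f : M -> S).
Hypothesis f0 : f mzero = 0.
Hypothesis f1 : f mone = 1.
Hypothesis fM : forall a b, f (mmul a b) = f a * f b.

Definition fsum_ext (x : fsum M) : S := \sum_(m <- fsum_terms x) f m.

Lemma sum_nzterms (s : seq M) : \sum_(m <- nzterms s) f m = \sum_(m <- s) f m.
Proof.
rewrite big_filter big_mkcond; apply: eq_bigr => m _.
by have [->|] := eqVneq m mzero; rewrite ?f0.
Qed.

(** Independence of the chosen representative: equivalent lists have the same nonzero terms up to
    reordering, and the zero terms contribute nothing by [f0]. *)
Lemma fsum_extE (s : seq M) : fsum_ext (fsum_of s) = \sum_(m <- s) f m.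
Proof.
rewrite /fsum_ext -sum_nzterms -[RHS]sum_nzterms.
exact/perm_big/fsum_terms_eqv.
Qed.

Lemma fsum_ext_inj m : fsum_ext (fsum_inj m) = f m.
Proof. by rewrite fsum_extE big_seq1. Qed.

Lemma fsum_ext_nmod_morphism : nmod_morphism fsum_ext.
Proof.
split=> [|x y]; first by rewrite fsum_extE big_nil.
rewrite -(fsum_termsK x) -(fsum_termsK y) [_ + _]fsum_addE !fsum_extE.
exact: big_cat.
Qed.

Lemma fsum_ext_monoid_morphism : monoid_morphism fsum_ext.
Proof.
split=> [|x y]; first by rewrite fsum_extE big_seq1.
rewrite -(fsum_termsK x) -(fsum_termsK y) [_ * _]fsum_mulE !fsum_extE.
rewrite big_allpairs_dep big_distrl; apply: eq_bigr => a _.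
by rewrite big_distrr; apply: eq_bigr => b _; rewrite fM.
Qed.

Lemma fsum_ext_rmorphism :
  exists F : {rmorphism fsum M -> S}, forall m, F (fsum_inj m) = f m.
Proof.
pose FA := GRing.isNmodMorphism.Build _ _ fsum_ext fsum_ext_nmod_morphism.
pose FM := GRing.isMonoidMorphism.Build _ _ fsum_ext fsum_ext_monoid_morphism.
pose F : {rmorphism fsum M -> S} := HB.pack fsum_ext FA FM.
by exists F => m; apply: fsum_ext_inj.
Qed.

End FsumExtension.

(** * Generated orders under semiring morphisms *)

Lemma gen_order_gen (S : comPzSemiRingType) (r : S -> S -> Prop) x y :
  r x y -> gen_order r x y.
Proof. by move=> rxy le _ rle; apply: rle. Qed.

(* The pullback of le along F need not be antisymmetric, hence its intersection
   with the generated order. *)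
Lemma gen_order_morph (S S' : comPzSemiRingType) (r : S -> S -> Prop)
    (le : S' -> S' -> Prop) (F : {rmorphism S -> S'}) :
  add_mul_order (gen_order r) -> add_mul_order le ->
  (forall x y, r x y -> le (F x) (F y)) ->
  forall x y, gen_order r x y -> le (F x) (F y).
Proof.
move=> [rr ra rt rD rM] [lr la lt lD lM] rF x y xy.
have /xy[] // : add_mul_order (fun x y => gen_order r x y /\ le (F x) (F y)).
  split=> [z|z w [zw _] [wz _]|w z t [zw Fzw] [wt Fwt]|z w t [zw Fzw]
          |z w t [zw Fzw]].
  - by split.
  - exact: ra.
  - by split; [apply: rt zw wt | apply: lt Fzw Fwt].
  - by split; [apply: rD | rewrite !rmorphD; apply: lD].
  - by split; [apply: rM | rewrite !rmorphM; apply: lM].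
by move=> u v ruv; split; [apply: gen_order_gen | apply: rF].
Qed.

(** * The max-times semiring and the order of the tropical hyperfield *)

Definition maxtimes (K : realType) : Type := {nonneg K}.

HB.instance Definition _ (K : realType) := Choice.on (maxtimes K).

Section MaxTimes.
Variable K : realType.
Implicit Types a b c : {nonneg K}.

Definition nng_max a b : {nonneg K} := (Num.max a%:num b%:num)%:nng.

Lemma nng_maxA : associative nng_max.
Proof. by move=> a b c; apply/val_inj; rewrite /= maxA. Qed.

Lemma nng_maxC : commutative nng_max.
Proof. by move=> a b; apply/val_inj; rewrite /= maxC. Qed.

Lemma nng_max0 : left_id 0%:nng nng_max.
Proof. by move=> a; apply/val_inj; rewrite /= max_r. Qed.

Lemma nng_mul_maxl : left_distributive (@nng_mul K) nng_max.
Proof. by move=> a b c; apply/val_inj; rewrite /= maxr_pMl. Qed.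

HB.instance Definition _ :=
  GRing.isNmodule.Build (maxtimes K) nng_maxA nng_maxC nng_max0.

HB.instance Definition _ := GRing.Nmodule_isComPzSemiRing.Build (maxtimes K)
  (@nng_mulA K) (@nng_mulC K) (@nng_mul1 K) nng_mul_maxl (@nng_mul0 K).

Lemma maxtimes_order :
  add_mul_order (fun a b : maxtimes K => a%:num <= b%:num).
Proof.
split=> [a|a b ab ba|b a c|a b c ab|a b c ab] //=.
- by apply/val_inj/le_anti; rewrite /= ab.
- exact: le_trans.
- by rewrite ge_max !le_max ab lexx orbT.
- exact: ler_wpM2r.
Qed.

(** If [c] exceeded both [a] and [b], the maximum would be [c] and would occur only once. *)
Lemma trop_rel_le c a b : trop_rel c a b -> c%:num <= Num.max a%:num b%:num.
Proof.
rewrite /trop_rel /= maxA; case: leP => // h.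
by move: h; rewrite gt_max => /andP[/lt_eqF-> /lt_eqF->]; rewrite eqxx.
Qed.

(** A maximum occurring only once would strictly exceed the other two entries, against the
    hypothesis that bounds it by them. *)
Lemma trop_relP c a b :
  c%:num <= Num.max a%:num b%:num -> a%:num <= Num.max b%:num c%:num ->
  b%:num <= Num.max a%:num c%:num -> trop_rel c a b.
Proof.
rewrite /trop_rel /=; set x := a%:num; set y := b%:num; set z := c%:num.
case: (ltgtP y z) => [yz|zy|<-].
- case: (ltgtP x z) => [xz|zx|->]; rewrite ?eqxx ?addn1 //.
  by rewrite [z <= _]leNgt gt_max xz yz.
- case: (ltgtP x y) => [xy|yx|->]; rewrite ?eqxx //.
  by rewrite [y <= Num.max x z]leNgt gt_max xy zy.
- by case: (ltgtP x y) => [/lt_eqF->|//|->]; rewrite !eqxx.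
Qed.

Lemma trop_order_le c a b :
  gen_order (add_rel (@trop_rel K)) (fsum_inj (c : nnreal K))
    (fsum_inj (a : nnreal K) + fsum_inj (b : nnreal K)) ->
  c%:num <= Num.max a%:num b%:num.
Proof.
(* The identity qualifies by [erefl], since [nnreal K] and [maxtimes K] share their zero, one and
   product. *)
have [F Finj] := @fsum_ext_rmorphism (nnreal K) (maxtimes K) idfun erefl erefl
  (fun _ _ => erefl).
move=> /(gen_order_morph (F := F) (@trop_order K) maxtimes_order).
rewrite rmorphD !Finj; apply.
by move=> _ _ [z [x [y [zxy -> ->]]]]; rewrite rmorphD !Finj; apply: trop_rel_le.
Qed.

End MaxTimes.

(** * Morphisms and seminorms *)

Section Seminorms.
Variables (K : realType) (R : comPzRingType).
Implicit Types (v : R -> {nonneg K}) (f : ob_hom (mon R) (tropical_hyperfield K)).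

(** The square of [v (-1)] is [v 1 = 1], and 1 is the only nonnegative square root of 1. *)
Lemma nonarch_seminormN v : nonarch_seminorm v ->
  forall a, (v (- a))%:num = (v a)%:num.
Proof.
move=> [_ v1 vM _] a; rewrite -mulN1r vM.
suff /eqP-> : (v (-1))%:num == 1 by rewrite mul1r.
by rewrite -(@pexpr_eq1 _ _ 2) // expr2 -vM mulrNN mulr1 v1.
Qed.

Lemma nonarch_seminorm_trop_rel v : nonarch_seminorm v ->
  forall a b, trop_rel (v (a + b)) (v a) (v b).
Proof.
move=> vP a b; have vN := nonarch_seminormN vP; have [_ _ _ vD] := vP.
apply: trop_relP; first exact: vD.
- by rewrite -{1}(addrK b a) maxC -(vN b); apply: vD.
- by rewrite -{1}(addKr a b) -(vN a); apply: vD.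
Qed.

Lemma ob_hom_nonarch_seminorm f : nonarch_seminorm (hom_bullet f : R -> {nonneg K}).
Proof.
case: f => v v0 v1 vM [F [Finj Fle]]; split=> [||a b|a b] /=.
- by rewrite [v 0]v0.
- by rewrite [v 1]v1.
- by rewrite [v _]vM.
(* The typing separates the two additions: [a + b] is taken in [R], while [inj a + inj b] is a
   formal sum. *)
pose inj (x : R) : ob_plus (mon R) := fsum_inj (x : mulmon R).
have /Fle : ob_le (inj (a + b)) (inj a + inj b).
  by apply: gen_order_gen; exists (a + b), a, b.
by rewrite rmorphD !Finj => /trop_order_le.
Qed.

Lemma nonarch_seminorm_ob_hom v : nonarch_seminorm v ->
  exists f, hom_bullet f = v.
Proof.
move=> vP; have [v0 v1 vM _] := vP.
pose w : mulmon R -> nnreal K := v.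
have w0 : w mzero = mzero by apply/val_inj.
have w1 : w mone = mone by apply/val_inj.
have wM a b : w (mmul a b) = mmul (w a) (w b) by apply/val_inj/vM.
have wext : exists F : {rmorphism fsum (mulmon R) -> fsum (nnreal K)},
    (forall a, F (fsum_inj a) = fsum_inj (w a)) /\
    (forall x y, gen_order (add_rel (@mon_rel R)) x y ->
       gen_order (add_rel (@trop_rel K)) (F x) (F y)).
  have [||a b|F Finj] := @fsum_ext_rmorphism _ _ (fun a => fsum_inj (w a)).
  - by rewrite w0 fsum_inj0.
  - by rewrite w1.
  - by rewrite wM fsum_injM.
  exists F; split=> //.
  (* Only the generating relations [c = a + b] remain to be checked. *)
  apply: gen_order_morph (@mon_order R) (@trop_order K) _ => x y.
  move=> [c [a [b [-> -> ->]]]]; apply: gen_order_gen.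
  rewrite rmorphD !Finj; do 3 eexists; split; [|reflexivity..].
  exact: nonarch_seminorm_trop_rel.
by exists (@OBHom (mon R) (tropical_hyperfield K) w w0 w1 wM wext).
Qed.

End Seminorms.

(** The extension to the semirings enters a morphism only through its existence, so all other fields
    are propositions and proof irrelevance identifies them. *)
Lemma hom_bullet_inj (B C : ordered_blueprint) : injective (@hom_bullet B C).
Proof.
move=> [f f0 f1 fM fF] [g g0 g1 gM gF] /= fg; case: g / fg g0 g1 gM gF => *.
by congr OBHom; apply: Prop_irrelevance.
Qed.

Theorem theorem2p2 (K : realType) (R : comPzRingType) :
  set_bij [set: ob_hom (mon R) (tropical_hyperfield K)]
    [set v : R -> {nonneg K} | nonarch_seminorm v]
    (fun f : ob_hom (mon R) (tropical_hyperfield K) => hom_bullet f).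
Proof.
split=> [f _|f g _ _|v vP].
- exact: ob_hom_nonarch_seminorm.
- exact: (@hom_bullet_inj (mon R) (tropical_hyperfield K) f g).
- by have [f <-] := nonarch_seminorm_ob_hom vP; exists f.
Qed.
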